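(* Let $G$ be a finite abelian group of order $n$ (written additively) and let $k\geq 1$ be an integer. Let $S$ be a sequence of $n+k$ elements of $G$, and set $t=|\operatorname{supp}(S)|$. Then one of the following conditions holds: (1) $0\in \sum_n(S)$. (2) $|\sum_n(S)|\geq k+t-1$.
   Context: A sequence over $G$ is a finite sequence of elements of $G$ with repetition allowed, where order is irrelevant (i.e. a finite multiset of elements of $G$). For a sequence $S=(a_1,\dots,a_m)$ over $G$ with $m\ge n$, $\operatorname{supp}(S)=\{a_1,\dots,a_m\}\subseteq G$ is the set of distinct elements occurring in $S$, and $$\sum_n(S)=\{a_{i_1}+\cdots+a_{i_n} : 1\leq i_1<\cdots<i_n\leq m\}$$ is the set of all elements of $G$ that are sums over a subsequence of $S$ of length $n$. *)

(* Defs.v *)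
From mathcomp Require Import all_boot all_algebra.

Set Implicit Arguments.
Unset Strict Implicit.
Unset Printing Implicit Defensive.

Import GRing.Theory.
Local Open Scope ring_scope.

(* A sequence over G is represented by a list S : seq G; both notions below
   are invariant under permutation of S. *)

Definition supp (G : finZmodType) (S : seq G) : {set G} := [set x in S].

(* The index set {i_1 < ... < i_n} is an n-element set of positions of S, so
   that repeated terms of S may be used up to their multiplicity. *)
Definition nsums (G : finZmodType) (n : nat) (S : seq G) : {set G} :=
  [set \sum_(i in I) S`_i | I : {set 'I_(size S)} & #|I| == n].

(* Main.v *)
Require Import Defs.
From mathcomp Require Import all_boot all_algebra.
From mathcomp Require Import zify.

Import GRing.Theory.
Local Open Scope ring_scope.

Set Implicit Arguments.
Unset Strict Implicit.
Unset Printing Implicit Defensive.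

(** A sequence is a family [a : I -> G] on a finite set [I] of positions, and its
    subsequences are the subsets of [I].

    Since n g = 0 for all g, translating every term by the same element changes
    neither the n-sums nor the number of distinct terms; so the term of largest
    multiplicity may be taken to be 0.  Let s be the sum of the whole sequence.
    Complementing positions turns the n-sums into s minus the k-sums: 0 is an
    n-sum exactly when s is a k-sum, and there are as many n-sums as k-sums.

    The first point ([subsums_sub_exact]) is that the sum of any at most k nonzero
    terms is a sum of exactly k terms.  Zeros serve as padding, and when they run
    out, zero-sum subsequences do: any n remaining terms contain a zero-sum
    subsequence no longer than the number h of zeros ([short_zerosum]), and adjoining
    such pieces to the zeros keeps every intermediate length available
    ([zerosum_pad]).  The short zero-sum subsequences come from Scherk's theorem on
    |A + B| ([card_sumset_ge]).

    The second point ([card_subsums_zerosum_free]) is that a zero-sum free W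
    with at least k >= 1 terms has at least k + |supp W| sums of at most k terms, the
    empty sum included.

    To conclude ([card_exact_sums]), let s not be a k-sum, and let W be a shortest
    subsequence of nonzero terms with sum s.  Minimality makes W zero-sum free, and
    W has more than k terms by the first point, so it contributes k + |supp W|
    k-sums.  Every nonzero term z outside supp W is also a k-sum, and a new one: if
    z were the sum of a part V of W, then V would have at least two terms, and
    exchanging V for z would give a shorter subsequence with sum s.  Since
    only one of the t distinct terms can be 0, this gives k + t - 1 sums. *)

(** * Scherk's theorem *)

(** By the Dyson transform: for a in A with a + B not inside A, replacing A by the
    union of A and a + B, and B by the intersection of B and A - a, shrinks B, keeps
    |A| + |B|, does not enlarge A + B, and preserves the uniqueness of the
    representation of 0. *)
Lemma card_sumset_ge (G : finZmodType) (A B : {set G}) :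
    0 \in A -> 0 \in B ->
    {in A & B, forall x y, x + y = 0 -> y = 0} ->
  (#|A| + #|B| <= #|[set (x + y)%R | x in A, y in B]|.+1)%N.
Proof.
have [m] := ubnP #|B|; elim: m A B => // m IHm A B /ltnSE leBm A0 B0 triv.
have [/existsP[b /andP[bB b_neq0]]|B_triv] := boolP [exists b in B, b != 0]; last first.
  have ->: B = [set 0].
    apply/setP=> b; rewrite inE; apply/idP/eqP => [bB|->//].
    by apply/eqP; apply: contraNT B_triv => nb; apply/existsP; exists b; rewrite bB.
  rewrite cards1 addn1 ltnS; apply/subset_leq_card/subsetP=> x xA.
  by apply/imset2P; exists x 0; rewrite ?inE ?addr0.
(* Otherwise A + b = A, so 0 = x + b with x in A although b is not 0. *)
have [a aA /subsetPn[_ /imsetP[c cB ->] acNA]] :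
    exists2 a, a \in A & ~~ ([set a + y | y in B] \subset A).
  apply/exists_inP; apply: contraR b_neq0 => /exists_inPn ABA.
  have /eqP Ab : [set x + b | x in A] == A.
    rewrite eqEcard card_imset ?leqnn ?andbT; last exact: addIr.
    apply/subsetP=> _ /imsetP[x xA ->].
    have /negPn/subsetP := ABA x xA; apply.
    exact: imset_f.
  have /imsetP[x xA x0] : 0 \in [set x + b | x in A] by rewrite Ab.
  by apply/eqP; apply: triv xA bB _.
pose A' := A :|: [set a + y | y in B].
pose B' := [set y in B | a + y \in A].
have cardAB : (#|A'| + #|B'| = #|A| + #|B|)%N.
  rewrite /A' cardsU card_imset; last exact: addrI.
  have ->: #|B'| = #|A :&: [set a + y | y in B]|.
    rewrite -(card_imset _ (addrI a)); congr #|pred_of_set _|.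
    apply/setP=> x; rewrite inE; apply/imsetP/andP=> [[y]|[xA /imsetP[y yB xE]]].
      by rewrite inE => /andP[yB ayA] ->; split=> //; apply: imset_f.
    by exists y; rewrite // inE yB -xE.
  by rewrite subnK // (leq_trans (subset_leq_card (subsetIl _ _))) ?leq_addr.
have ltB'B : (#|B'| < #|B|)%N.
  apply/proper_card/properP; split; first by apply/subsetP=> y; rewrite inE => /andP[].
  by exists c; rewrite // inE (negPf acNA) andbF.
rewrite -cardAB.
apply: leq_trans (IHm A' B' _ _ _ _) _; first exact: leq_trans ltB'B leBm.
- by rewrite inE A0.
- by rewrite inE B0 addr0.
- move=> x y xA' ; rewrite inE => /andP[yB ayA]; move: xA'.
  rewrite inE => /orP[xA|/imsetP[z zB ->]]; first exact: triv.
  rewrite addrAC => xy0.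
  have z0 := triv _ _ ayA zB xy0.
  by apply: triv aA yB _; rewrite -xy0 z0 addr0.
rewrite ltnS; apply/subset_leq_card/subsetP=> _ /imset2P[x y xA' yB' ->].
move: xA' yB'; rewrite !inE => /orP[xA|/imsetP[z zB ->]] /andP[yB ayA].
  exact: imset2_f.
by rewrite addrAC; apply: imset2_f.
Qed.

(** * Sums of short subsequences *)

Definition subsums (I : finType) (G : finZmodType) (a : I -> G) k (W : {set I}) : {set G} :=
  [set \sum_(i in V) a i | V : {set I} & (V \subset W) && (#|V| <= k)%N].

Definition zerosum_free (I : finType) (G : finZmodType) (a : I -> G) k (W : {set I}) :=
  forall V : {set I}, V \subset W -> (#|V| <= k)%N -> \sum_(i in V) a i = 0 -> V = set0.

Lemma subsumsP (I : finType) (G : finZmodType) (a : I -> G) k (W : {set I}) (x : G) :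
  reflect (exists V : {set I}, [/\ V \subset W, (#|V| <= k)%N & x = \sum_(i in V) a i])
          (x \in subsums a k W).
Proof.
apply: (iffP imsetP) => [[V]|[V [sVW leVk ->]]].
  by rewrite inE => /andP[sVW leVk] ->; exists V.
by exists V; rewrite // inE sVW.
Qed.

Lemma subsums_f (I : finType) (G : finZmodType) (a : I -> G) k (V W : {set I}) :
  V \subset W -> (#|V| <= k)%N -> \sum_(i in V) a i \in subsums a k W.
Proof. by move=> sVW leVk; apply/subsumsP; exists V. Qed.

Lemma subsums0 (I : finType) (G : finZmodType) (a : I -> G) k (W : {set I}) :
  0 \in subsums a k W.
Proof. by apply/subsumsP; exists set0; rewrite sub0set cards0 big_set0. Qed.

Lemma subsumsS (I : finType) (G : finZmodType) (a : I -> G) k l (V W : {set I}) :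
  (k <= l)%N -> V \subset W -> subsums a k V \subset subsums a l W.
Proof.
move=> lekl sVW; apply/subsetP=> x /subsumsP[U [sUV leUk ->]].
by apply: subsums_f; [apply: subset_trans sVW | apply: leq_trans lekl].
Qed.

Lemma sum_disjointU (I : finType) (G : finZmodType) (a : I -> G) (U V : {set I}) :
  [disjoint U & V] ->
  \sum_(i in U :|: V) a i = \sum_(i in U) a i + \sum_(i in V) a i.
Proof. by move=> ?; rewrite -bigU //; apply: eq_bigl => i; rewrite !inE. Qed.

Lemma transversal_exists (I : finType) (T : finType) (a : I -> T) (U : {set I}) :
  exists R : {set I}, [/\ R \subset U, a @: R = a @: U & {in R &, injective a}].
Proof.
pose R := [set i in U | [pick j in U | a j == a i] == Some i].
exists R; have sRU : R \subset U by apply/subsetP=> i; rewrite inE => /andP[].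
split=> //.
  apply/eqP; rewrite eqEsubset imsetS //=; apply/subsetP=> _ /imsetP[i iU ->].
  case: (pickP [pred j in U | a j == a i]) => [j /andP[/= jU /eqP aji]|/(_ i)]; last first.
    by rewrite /= iU eqxx.
  case pick_i: [pick j in U | a j == a i] => [l|]; last first.
    by move: pick_i; case: pickP => // /(_ i); rewrite iU eqxx.
  have [lU ali] : l \in U /\ a l = a i.
    by move: pick_i; case: pickP => // m /andP[mU /eqP ami] [<-].
  by rewrite -ali; apply: imset_f; rewrite inE lU ali pick_i /=.
move=> i j; rewrite !inE => /andP[_ /eqP pi] /andP[_ /eqP pj] aij.
by move: pi; rewrite aij pj => -[].
Qed.

(** Partition U into h subsequences of distinct terms and add their supports, each
    completed by 0, one by one: the absence of short zero-sums is the hypothesis of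
    Scherk's theorem at each step. *)
Lemma card_subsums_mult (I : finType) (G : finZmodType) (a : I -> G) h (U : {set I}) :
    (forall g, #|[set i in U | a i == g]| <= h)%N -> zerosum_free a h U ->
  (#|U| < #|subsums a h U|)%N.
Proof.
elim: h U => [|h IHh] U mult zsf.
  suff ->: U = set0 by rewrite cards0; apply/card_gt0P; exists 0; apply: subsums0.
  apply/eqP/set0Pn=> -[i iU]; have := mult (a i); rewrite leqn0 cards_eq0.
  by move/eqP/setP/(_ i); rewrite !inE iU eqxx.
(* R takes one position for each value, so U :\: R has multiplicities <= h. *)
have [R [sRU aRU injR]] := transversal_exists a U.
have R_neq0 i : i \in R -> a i != 0.
  move=> iR; apply/eqP=> ai0.
  have /setP/(_ i) : [set i] = set0.
    by apply: zsf; rewrite ?sub1set ?(subsetP sRU) ?cards1 ?big_set1.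
  by rewrite !inE eqxx.
have ltUR : (#|U :\: R| < #|subsums a h (U :\: R)|)%N.
  apply: IHh => [g|V sV leV]; last first.
    by apply: zsf; [apply: subset_trans sV (subsetDl _ _) | apply: leqW].
  have [/imsetP[i iR ->]|gNR] := boolP (g \in a @: R).
    rewrite -ltnS; apply: leq_trans (mult (a i)); apply/proper_card/properP; split.
      by apply/subsetP=> j; rewrite !inE -andbA => /and3P[_ -> ->].
    by exists i; rewrite !inE ?iR // (subsetP sRU) ?eqxx.
  rewrite (_ : finset _ = set0) ?cards0 //; apply/setP=> i; rewrite !inE -andbA.
  apply/and3P=> -[_ iU /eqP aig]; case/negP: gNR.
  by rewrite aRU -aig imset_f.
pose B := 0 |: a @: R.
have disjR (V : {set I}) : V \subset U :\: R -> {in R, forall i, i \notin V}.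
  by move=> sV i iR; apply/negP=> /(subsetP sV); rewrite inE iR.
have sumset_sub : [set x + y | x in subsums a h (U :\: R), y in B] \subset subsums a h.+1 U.
  apply/subsetP=> _ /imset2P[_ y /subsumsP[V [sV leV ->]] yB ->].
  have sVU : V \subset U by apply: subset_trans sV (subsetDl _ _).
  case/setU1P: yB => [->|/imsetP[i iR ->]].
    by rewrite addr0 subsums_f // leqW.
  rewrite addrC -big_setU1 ?(disjR V) //; apply: subsums_f.
    by rewrite subUset sub1set (subsetP sRU).
  by rewrite cardsU1 (disjR V).
have cardB : #|B| = #|R|.+1.
  rewrite cardsU1 (card_in_imset injR) (_ : 0 \notin _) //.
  by apply/imsetP=> -[i iR /esym/eqP]; rewrite (negPf (R_neq0 i iR)).
have := card_sumset_ge (subsums0 a h (U :\: R)) (setU11 0 (a @: R)) _.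
rewrite -/B cardB => /(_ _) main.
have {main} : (#|subsums a h (U :\: R)| + #|R|.+1 <= #|subsums a h.+1 U|.+1)%N.
  apply: leq_trans (main _) _; last by rewrite ltnS subset_leq_card.
  move=> _ y /subsumsP[V [sV leV ->]] /setU1P[//|/imsetP[i iR ->]].
  rewrite addrC -big_setU1 ?(disjR V) // => sum0.
  have /setP/(_ i) : i |: V = set0; last by rewrite !inE eqxx.
  apply: zsf => //; last by rewrite cardsU1 (disjR V).
  rewrite subUset sub1set (subsetP sRU) //=.
  exact: subset_trans sV (subsetDl _ _).
by have := cardsID R U; rewrite (setIidPr sRU); lia.
Qed.

(** * Zero-sum free sequences *)

(** Deleting a term a_i loses at most one distinct term, while the sums that use a_i are
    nonzero: so X = subsums k W contains the disjoint union of {0} and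
    a_i + subsums (k-1) (W - i), and induction fails by at most 1.  If it does fail
    by 1, then for every i this union is all of X, and X = subsums k (W - i).  The
    former says that subtracting a_i maps the nonzero elements of X into X; the
    latter that - a_i is not in X.  For two distinct terms x and y this is
    contradictory: x, then x - y, then - y would all lie in X.  The case k = |W| is
    outside this scheme, because W - i has too few terms; there the total sum of W is
    an additional value. *)
Lemma card_subsums_zerosum_free (I : finType) (G : finZmodType) (a : I -> G)
    k (W : {set I}) :
    zerosum_free a #|W| W -> (0 < k <= #|W|)%N ->
  (k + #|a @: W| <= #|subsums a k W|)%N.
Proof.
have [m] := ubnP #|W|; elim: m k W => // m IHm k W /ltnSE leWm zsf.
have zsfS (V : {set I}) : V \subset W -> zerosum_free a #|V| V.
  move=> sVW U sUV _; apply: zsf; first exact: subset_trans sVW.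
  exact: subset_leq_card (subset_trans sUV sVW).
have sum_neq0 (V : {set I}) i : V \subset W -> i \in V -> \sum_(j in V) a j != 0.
  move=> sVW iV; apply/eqP=> /(zsf V sVW (subset_leq_card sVW)) V0.
  by rewrite V0 inE in iV.
elim: k => // -[_ _ | k IHk /andP[_ leKW]].
  have a_neq0 : 1%N = (0 \notin a @: W).
    case: imsetP => // -[i iW ai0].
    by have := @sum_neq0 [set i] i; rewrite sub1set iW inE eqxx big_set1 -ai0 eqxx => ->.
  rewrite [in leqLHS]a_neq0 -cardsU1; apply/subset_leq_card; rewrite subUset sub1set subsums0.
  apply/subsetP=> _ /imsetP[i iW ->]; apply/subsumsP; exists [set i].
  by rewrite sub1set iW cards1 big_set1.
have {}IHk : (k.+1 + #|a @: W| <= #|subsums a k.+1 W|)%N.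
  exact: IHk (ltnW leKW).
move: leKW; rewrite leq_eqVlt => /orP[/eqP eqKW | ltKW].
  rewrite addSn; apply: leq_ltn_trans IHk _; apply/proper_card/properP.
  split; first exact: subsumsS.
  exists (\sum_(i in W) a i); first by rewrite subsums_f ?eqKW.
  apply/subsumsP=> -[V [sVW leV]]; rewrite (big_setID V) /= (setIidPr sVW).
  rewrite -[RHS]addr0 => /addrI sum0.
  have := zsf (W :\: V) (subsetDl _ _) (subset_leq_card (subsetDl _ _)) sum0.
  move/eqP; rewrite setD_eq0 => /subset_leq_card; rewrite -eqKW.
  by move/leq_trans/(_ leV); rewrite ltnn.
set X := subsums a k.+2 W.
pose Y i := subsums a k.+1 (W :\ i).
pose Z i : {set G} := 0 |: [set a i + y | y in Y i].
have shift_sub i : i \in W -> Z i \subset X.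
  move=> iW; rewrite /Z subUset sub1set subsums0; apply/subsetP.
  move=> _ /imsetP[_ /subsumsP[V [sV leV ->]] ->].
  have iNV : i \notin V by apply/negP=> /(subsetP sV); rewrite !inE eqxx.
  rewrite -big_setU1 //; apply: subsums_f; last by rewrite cardsU1 iNV.
  by rewrite subUset sub1set iW (subset_trans sV) ?subD1set.
have shift_card i : i \in W -> #|Z i| = #|Y i|.+1.
  move=> iW; rewrite /Z cardsU1 card_imset; last exact: addrI.
  rewrite (_ : 0 \notin _) //; apply/imsetP=> -[_ /subsumsP[V [sV leV ->]] ].
  have iNV : i \notin V by apply/negP=> /(subsetP sV); rewrite !inE eqxx.
  rewrite -big_setU1 // => /esym/eqP; apply/negP/(sum_neq0 _ i); last exact: setU11.
  by rewrite subUset sub1set iW (subset_trans sV) ?subD1set.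
have IHW i l : i \in W -> (0 < l <= k.+2)%N ->
    (l + #|a @: (W :\ i)| <= #|subsums a l (W :\ i)|)%N.
  move=> iW /andP[l_gt0 leKl]; have := cardsD1 i W; rewrite iW => cardW.
  by apply: IHm; [lia | apply/zsfS/subD1set | lia].
have drop_card i : i \in W -> (#|a @: W| <= #|a @: (W :\ i)|.+1)%N.
  by move=> iW; rewrite -{1}(setD1K iW) imsetU1 cardsU1 -add1n leq_add2r leq_b1.
(* If the bound fails, then it fails by 1, whichever i is deleted. *)
rewrite leqNgt; apply/negP=> ltX.
have drop i : i \in W -> #|a @: W| = #|a @: (W :\ i)|.+1.
  move=> iW; have := subset_leq_card (shift_sub i iW); rewrite shift_card //.
  have := IHW i k.+1 iW (leqnSn _); have := drop_card i iW; rewrite /Y; lia.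
have Xshift i : i \in W -> Z i = X.
  move=> iW; have leXY : (#|X| <= #|Y i|.+1)%N.
    by have := IHW i k.+1 iW (leqnSn _); have := drop i iW; rewrite /Y; lia.
  by apply/eqP; rewrite eqEcard shift_sub //= shift_card.
have XD1 i : i \in W -> subsums a k.+2 (W :\ i) = X.
  move=> iW; have leXi : (#|X| <= #|subsums a k.+2 (W :\ i)|)%N.
    by have := IHW i k.+2 iW (leqnn _); have := drop i iW; lia.
  by apply/eqP; rewrite eqEcard subsumsS ?subD1set.
have mem_shift i x : i \in W -> x \in X -> x != 0 -> x - a i \in X.
  move=> iW; rewrite -{1}(Xshift i iW) => /setU1P[->|]; first by rewrite eqxx.
  case/imsetP=> y yY -> _; rewrite addrAC subrr add0r.
  by apply: subsetP yY; apply: subsumsS; rewrite ?subD1set.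
have opp_notin i : i \in W -> - a i \notin X.
  move=> iW; rewrite -(XD1 i iW); apply/subsumsP=> -[V [sV leV /eqP]].
  have iNV : i \notin V by apply/negP=> /(subsetP sV); rewrite !inE eqxx.
  rewrite eq_sym -addr_eq0 addrC -big_setU1 //; apply/negP/(sum_neq0 _ i); last exact: setU11.
  by rewrite subUset sub1set iW (subset_trans sV) ?subD1set.
have /card_gt1P[i [j [iW jW neq_ij]]] : (1 < #|W|)%N by lia.
have neq_a : a i != a j.
  apply/eqP=> aij; have := drop i iW.
  rewrite -{1}(setD1K iW) imsetU1 (setUidPr _); first lia.
  by rewrite sub1set aij imset_f // !inE eq_sym neq_ij.
have aiX : a i \in X by rewrite -(big_set1 (+%R) i a) subsums_f ?sub1set ?cards1.
have ai_neq0 : a i != 0.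
  by rewrite -(big_set1 (+%R) i a); apply: (sum_neq0 _ i); rewrite ?sub1set ?inE.
have := mem_shift i _ iW (mem_shift j _ jW aiX ai_neq0).
rewrite subr_eq0 neq_a addrAC subrr add0r => /(_ isT); exact/negP/opp_notin.
Qed.

(** * Padding by zero-sum subsequences *)

(** Otherwise U would have more than |G| distinct sums. *)
Lemma short_zerosum (I : finType) (G : finZmodType) (a : I -> G) h (U : {set I}) :
    (forall g, #|[set i in U | a i == g]| <= h)%N -> (#|G| <= #|U|)%N ->
  exists D : {set I}, [/\ D \subset U, (0 < #|D| <= h)%N & \sum_(i in D) a i = 0].
Proof.
move=> mult leGU; pose P (D : {set I}) :=
  [&& D \subset U, (0 < #|D| <= h)%N & \sum_(i in D) a i == 0].
have [/existsP[D /and3P[sD cD /eqP sum0]]|noD] := boolP [exists D, P D].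
  by exists D.
have := card_subsums_mult mult.
have zsf : zerosum_free a h U.
  move=> D sDU leD sum0; apply/eqP; apply: contraNT noD => D_neq0.
  by apply/existsP; exists D; rewrite /P sDU card_gt0 D_neq0 leD sum0 eqxx.
move/(_ zsf); have : (#|subsums a h U| <= #|G|)%N by exact: max_card.
by lia.
Qed.

(** E grows from the set of zeros by zero-sum pieces D.  Each D can be chosen no
    longer than the number of zeros, hence no longer than E, and therefore adjoining
    D leaves no gap in the lengths of zero-sum subsequences.  Such a D exists as
    long as |G| positions remain outside E and V. *)
Lemma zerosum_pad (I : finType) (G : finZmodType) (a : I -> G) (V : {set I}) m :
    (forall g, #|[set i | a i == g]| <= #|[set i | a i == 0%R]|)%N ->
    {in V, forall i, a i != 0} -> (#|G| + m + #|V| <= #|I|.+1)%N ->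
  exists E : {set I},
    [/\ [disjoint E & V], [set i | a i == 0] \subset E, (m <= #|E|)%N
      & forall j, (j <= #|E|)%N ->
        exists F : {set I}, [/\ F \subset E, #|F| = j & \sum_(i in F) a i = 0]].
Proof.
move=> mult V_neq0; set Z := [set i | a i == 0].
elim: m => [_|m IHm cardI].
  exists Z; split=> //; first rewrite disjoint_sym.
    apply/pred0P=> i; rewrite /= inE andbC; apply: contraTF isT => /andP[ai0 iV].
    by rewrite (negPf (V_neq0 i iV)) in ai0.
  move=> j lej; have /card_geqP[s [us ss sZ]] := lej.
  exists [set i in s]; split; first by apply/subsetP=> i; rewrite inE => /sZ.
    by rewrite -ss -(card_uniqP us) cardsE.
  by apply: big1 => i; rewrite inE => /sZ; rewrite inE => /eqP.
have [|E [disjEV sZE lemE lenE]] := IHm; first lia.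
have [ltmE|] := ltnP m #|E|; first by exists E.
move=> leEm; have cardE : #|E| = m by apply/eqP; rewrite eqn_leq leEm.
pose U := ~: (E :|: V).
have cardU : (#|G| <= #|U|)%N.
  have := cardsC (E :|: V); have := cardsU E V.
  by rewrite (disjoint_setI0 disjEV) cards0 -/U; lia.
have [g|D [sDU /andP[D_gt0 leDZ] D0]] := @short_zerosum _ _ a #|Z| U _ cardU.
  by apply: leq_trans (mult g); apply/subset_leq_card/subsetP=> i; rewrite !inE => /andP[].
have [disjED disjVD] : [disjoint E & D] /\ [disjoint V & D].
  split; rewrite disjoint_sym disjoints_subset (subset_trans sDU) //.
    by rewrite setCS subsetUl.
  by rewrite setCS subsetUr.
exists (E :|: D); split.
- rewrite disjoints_subset subUset -!disjoints_subset disjEV.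
  by rewrite disjoint_sym disjVD.
- exact: subset_trans sZE (subsetUl _ _).
- have := cardsU E D; rewrite (disjoint_setI0 disjED) cards0; lia.
move=> j; rewrite cardsU (disjoint_setI0 disjED) cards0 subn0 => lej.
have [/lenE[F [sFE cF F0]]|ltEj] := leqP j #|E|.
  by exists F; split=> //; apply: subset_trans sFE (subsetUl _ _).
have leZE := subset_leq_card sZE.
have [|F [sFE cF F0]] := lenE (j - #|D|)%N; first lia.
have disjFD : [disjoint F & D] := disjointWl sFE disjED.
exists (F :|: D); split; first exact: setSU.
  by rewrite cardsU (disjoint_setI0 disjFD) cards0 cF; lia.
by rewrite sum_disjointU // F0 D0 addr0.
Qed.

(** The padding has to avoid the positions already summed, and |G| + k positions
    leave enough room for it.  The largest multiplicity must be that of 0: the empty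
    sum is not a sum of k terms if, for instance, k = 1 and all terms are nonzero. *)
Lemma subsums_sub_exact (I : finType) (G : finZmodType) (a : I -> G) k :
    (forall g, #|[set i | a i == g]| <= #|[set i | a i == 0%R]|)%N ->
    (#|G| + k <= #|I|)%N ->
  subsums a k [set i | a i != 0] \subset
    [set \sum_(i in V) a i | V : {set I} & #|V| == k].
Proof.
move=> mult cardI; apply/subsetP=> _ /subsumsP[V [sV leV ->]].
have V_neq0 : {in V, forall i, a i != 0} by move=> i /(subsetP sV); rewrite inE.
have [|E [disjEV _ leE lenE]] := zerosum_pad (m := (k - #|V|)%N) mult V_neq0; first lia.
have [F [sFE cF F0]] := lenE _ leE.
have disjFV : [disjoint F & V] := disjointWl sFE disjEV.
apply/imsetP; exists (F :|: V); last by rewrite sum_disjointU // F0 add0r.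
by rewrite inE cardsU (disjoint_setI0 disjFV) cards0 cF subn0 subnK.
Qed.

(** * The bound *)

(** This is the theorem after translation and complementation: s is the total sum,
    and the k-sums take the place of the n-sums. *)
Lemma card_exact_sums (I : finType) (G : finZmodType) (a : I -> G) k :
    (forall g, #|[set i | a i == g]| <= #|[set i | a i == 0%R]|)%N ->
    (#|G| + k <= #|I|)%N -> (0 < k)%N ->
    \sum_i a i \notin [set \sum_(i in V) a i | V : {set I} & #|V| == k] ->
  (k + #|a @: [set: I]| <= #|[set (\sum_(i in V) a i)%R | V : {set I} & #|V| == k]|.+1)%N.
Proof.
move=> mult cardI k_gt0; set Q := imset _ _ => sNQ.
have sTQ := subsums_sub_exact mult cardI; rewrite -/Q in sTQ.
set T := [set i | a i != 0] in sTQ.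
have sumT : \sum_(i in T) a i = \sum_i a i.
  rewrite [RHS](bigID (mem T)) /= [X in _ + X]big1 ?addr0 // => i.
  by rewrite inE negbK => /eqP.
pose P (V : {set I}) := (V \subset T) && (\sum_(i in V) a i == \sum_i a i).
have PT : P T by rewrite /P subxx sumT eqxx.
case: (arg_minnP (fun V : {set I} => #|V|) PT) => W /andP[sWT /eqP sumW] minW.
have ltkW : (k < #|W|)%N.
  rewrite ltnNge; apply: contra sNQ => leWk; rewrite -sumW.
  exact: subsetP sTQ _ (subsums_f _ sWT leWk).
have zsf : zerosum_free a #|W| W.
  move=> V sVW _ sumV; apply/eqP; rewrite -cards_eq0.
  have := minW (W :\: V); rewrite /P (subset_trans (subsetDl _ _) sWT) /=.
  have -> : \sum_(i in W :\: V) a i = \sum_i a i.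
    by rewrite -sumW [RHS](big_setID V) /= (setIidPr sVW) sumV add0r.
  rewrite eqxx => /(_ isT).
  by have := cardsID V W; rewrite (setIidPr sVW); lia.
have := card_subsums_zerosum_free (k := k) zsf; rewrite k_gt0 (ltnW ltkW) => /(_ isT) leX.
(* A term z in D which is the sum of V \subset W could replace V in W. *)
pose D := a @: T :\: a @: W.
have disjXD : [disjoint subsums a k W & D].
  rewrite disjoints_subset; apply/subsetP=> _ /subsumsP[V [sVW leV ->]].
  rewrite inE; apply/negP=> /setDP[/imsetP[i iT sumV] /negP]; apply.
  have iNT : a i != 0 by rewrite inE in iT.
  apply: contraT => aNW.
  have iNW : i \notin W by apply: contra aNW => iW; rewrite sumV imset_f.
  have V_gt1 : (1 < #|V|)%N.
    rewrite ltnNge; apply/negP; rewrite leq_eqVlt ltnS leqn0 cards_eq0.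
    case/orP=> [/cards1P[j V1]|/eqP V0]; last by rewrite -sumV V0 big_set0 eqxx in iNT.
    by rewrite V1 big_set1 imset_f // -sub1set -V1 in aNW.
  have iNWV : i \notin W :\: V by rewrite inE (negPf iNW) andbF.
  have := minW (i |: W :\: V); rewrite /P subUset sub1set iT /=.
  rewrite (subset_trans (subsetDl _ _) sWT).
  have -> : \sum_(j in i |: W :\: V) a j = \sum_j a j.
    by rewrite big_setU1 // -sumV -sumW [RHS](big_setID V) /= (setIidPr sVW).
  rewrite eqxx cardsU1 iNWV => /(_ isT).
  by have := cardsID V W; rewrite (setIidPr sVW); lia.
have sXDQ : subsums a k W :|: D \subset Q.
  rewrite subUset (subset_trans (subsumsS _ (leqnn k) sWT) sTQ) /=.
  apply: subset_trans sTQ; apply/subsetP=> x /setDP[/imsetP[i iT ->] _].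
  by rewrite -(big_set1 (+%R) i a) subsums_f ?sub1set ?cards1.
have cardXD : (#|subsums a k W| + #|D| <= #|Q|)%N.
  have := subset_leq_card sXDQ.
  by rewrite cardsU (disjoint_setI0 disjXD) cards0 subn0.
have cardD : (#|D| + #|a @: W| = #|a @: T|)%N.
  have := cardsID (a @: W) (a @: T).
  by rewrite (setIidPr (imsetS a sWT)) -/D addnC.
have leT : (#|a @: [set: I]| <= #|a @: T|.+1)%N.
  have : a @: [set: I] \subset 0 |: a @: T.
    apply/subsetP=> _ /imsetP[i _ ->]; rewrite !inE.
    have [//|ai] := eqVneq (a i) 0; by rewrite imset_f // inE.
  move/subset_leq_card/leq_trans; apply; rewrite cardsU1 -add1n leq_add2r.
  exact: leq_b1.
by lia.
Qed.

Lemma mulrn_card_eq0 (G : finZmodType) (g : G) : g *+ #|G| = 0.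
Proof.
apply: (addrI (\sum_(x : G) x)); rewrite addr0 -sumr_const -big_split /=.
by rewrite [RHS](reindex_inj (addIr g)).
Qed.

Theorem theorem1p1 (G : finZmodType) (n k : nat) (S : seq G) (t : nat)
    (hn : #|G| = n) (hk : (1 <= k)%N) (hS : size S = (n + k)%N)
    (ht : t = #|supp S|) :
  0 \in nsums n S \/ (k + t - 1 <= #|nsums n S|)%N.
Proof.
pose mult g := #|[set i : 'I_(size S) | S`_i == g]|.
have [g _ max_g] := arg_maxnP mult (erefl : xpredT (0 : G)).
pose a (i : 'I_(size S)) := S`_i - g.
pose Q := [set \sum_(i in V) a i | V : {set 'I_(size S)} & #|V| == k].
have multa : (forall x, #|[set i | a i == x]| <= #|[set i | a i == 0%R]|)%N.
  move=> x.
  have E y : #|[set i | a i == y]| = mult (y + g).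
    by congr #|pred_of_set _|; apply/setP=> i; rewrite !inE subr_eq.
  by rewrite !E add0r; apply: max_g.
have sum_a (V : {set 'I_(size S)}) : #|V| = n -> \sum_(i in V) a i = \sum_(i in V) S`_i.
  by move=> cV; rewrite sumrB sumr_const cV -hn mulrn_card_eq0 subr0.
have cardI : #|'I_(size S)| = (n + k)%N by rewrite card_ord.
have cardC (V : {set 'I_(size S)}) : (#|V| == k) = (#|~: V| == n).
  by have := cardsC V; rewrite cardI; lia.
have nsumsE : nsums n S = [set \sum_i a i - x | x in Q].
  have sumC (V : {set 'I_(size S)}) : \sum_(i in ~: V) a i = \sum_i a i - \sum_(i in V) a i.
    rewrite [X in _ = X - _](bigID (mem V)) /= addrAC subrr add0r.
    by apply: eq_bigl => i; rewrite inE.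
  apply/setP=> x; apply/imsetP/imsetP=> [[V]|[_ /imsetP[V cV ->] ->]].
    rewrite inE => /eqP cV ->; exists (\sum_(i in ~: V) a i).
      by apply: imset_f; rewrite inE cardC setCK cV.
    by rewrite -sumC setCK sum_a.
  rewrite inE cardC in cV; exists (~: V); first by rewrite inE.
  by rewrite -sumC sum_a //; apply/eqP.
have cardQ : #|nsums n S| = #|Q|.
  by rewrite nsumsE card_imset // => x y /addrI/oppr_inj.
have tE : t = #|a @: [set: 'I_(size S)]|.
  rewrite ht -(card_imset _ (addIr (- g))); congr #|pred_of_set _|.
  apply/setP=> x; apply/imsetP/imsetP=> [[y]|[i _ ->]].
    rewrite inE => /(nthP 0)[i lti <-] ->.
    by exists (Ordinal lti).
  by exists S`_i; rewrite // inE mem_nth.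
have [sQ|sNQ] := boolP (\sum_i a i \in Q); [left | right].
  by rewrite nsumsE; apply/imsetP; exists (\sum_i a i); rewrite ?subrr.
rewrite cardQ tE; have := card_exact_sums multa _ hk sNQ; rewrite -/Q.
by rewrite cardI hn leqnn leq_subLR add1n => /(_ isT).
Qed.
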